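(* Let $G$ and $H$ be any two finite graphs, and let $G\times H$ be their categorical product. Then (a) $\zeta_s(G\times H)=\min\{\zeta_s(G),\zeta_s(H)\}$; (b) $\zeta(G\times H)\geq \max\bigl\{\min\{\zeta(G),\zeta_s(H)-1\},\ \min\{\zeta_s(G)-1,\zeta(H)\}\bigr\}$. Here $\zeta$ denotes the altermatic number and $\zeta_s$ the strong altermatic number.
   Context: Graphs are finite, simple, undirected, with nonempty vertex set. A hypergraph $\mathcal{H}=(V(\mathcal{H}),E(\mathcal{H}))$ consists of a nonempty finite vertex set $V(\mathcal{H})$ and a set $E(\mathcal{H})$ of distinct nonempty subsets of $V(\mathcal{H})$ (isolated vertices and singleton edges are allowed). The general Kneser graph ${\rm KG}(\mathcal{H})$ has vertex set $E(\mathcal{H})$, two vertices being adjacent iff the corresponding edges are disjoint. A homomorphism $G\to H$ of graphs is an adjacency-preserving map $V(G)\to V(H)$. Write $G\longleftrightarrow H$ (homomorphically equivalent) if there are homomorphisms $G\to H$ and $H\to G$. For $X=(x_1,\dots,x_n)\in\{-1,0,+1\}^n$, the alternation number $alt(X)$ is the length of a longest subsequence of nonzero entries of $X$ in which any two consecutive terms have opposite signs; $alt((0,\dots,0))=0$. For a set $V$ of size $n$ let $L_V$ be the set of linear orderings of $V$; for $\sigma\in L_V$ let $\sigma(j)$ be the $j$-th element of $V$ in the ordering $\sigma$, and put $X^+_\sigma=\{\sigma(j): x_j=+1\}$ and $X^-_\sigma=\{\sigma(j): x_j=-1\}$. For a hypergraph $\mathcal{H}$ with $n=|V(\mathcal{H})|$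 and $\sigma\in L_{V(\mathcal{H})}$: $alt_\sigma(\mathcal{H})$ is the largest integer $k$ such that there is $X\in\{-1,0,+1\}^n$ with $alt(X)=k$ such that neither $X^+_\sigma$ nor $X^-_\sigma$ contains (as a subset) an edge of $\mathcal{H}$; $salt_\sigma(\mathcal{H})$ is the largest integer $k$ such that there is $X\in\{-1,0,+1\}^n$ with $alt(X)=k$ such that at most one of $X^+_\sigma$ and $X^-_\sigma$ contains an edge of $\mathcal{H}$. Set $alt(\mathcal{H})=\min_{\sigma\in L_{V(\mathcal{H})}} alt_\sigma(\mathcal{H})$ and $salt(\mathcal{H})=\min_{\sigma\in L_{V(\mathcal{H})}} salt_\sigma(\mathcal{H})$. The altermatic number and the strong altermatic number of a graph $G$ are $$\zeta(G)=\max_{\mathcal{H}}\{|V(\mathcal{H})|-alt(\mathcal{H}): {\rm KG}(\mathcal{H})\longleftrightarrow G\},\qquad \zeta_s(G)=\max_{\mathcal{H}}\{|V(\mathcal{H})|+1-salt(\mathcal{H}): {\rm KG}(\mathcal{H})\longleftrightarrow G\},$$ the maxima being over all hypergraphs $\mathcal{H}$ with ${\rm KG}(\mathcal{H})\longleftrightarrow G$. (These maxima exist: it is a known theorem that both are bounded above by the chromatic number $\chi(G)$.) The categorical product $G\times H$ has vertex set $V(G)\times V(H)$, with $(u_1,u_2)$ and $(v_1,v_2)$ adjacent iff $u_1v_1\in E(G)$ and $u_2v_2\in E(H)$. *)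

(* Defs.v *)
From HB Require Import structures.
From mathcomp Require Import all_boot.

Set Implicit Arguments.
Unset Strict Implicit.
Unset Printing Implicit Defensive.

Definition is_maximum (P : nat -> Prop) (k : nat) : Prop :=
  P k /\ forall j : nat, P j -> j <= k.

(* The vertex set of a graph may be empty here, so that the Kneser graph of a
   hypergraph without edges is a graph; nonemptiness is a separate hypothesis.
   A nonempty graph has no homomorphism to an empty one, so edgeless hypergraphs
   never represent a nonempty graph. *)
Record graph := Graph {
  gvert :> finType;
  adj : rel gvert;
  adj_sym : symmetric adj;
  adj_irr : irreflexive adj
}.

Definition hom (G H : graph) : Prop :=
  exists f : G -> H, forall u v : G, adj u v -> adj (f u) (f v).

Definition hom_equiv (G H : graph) : Prop := hom G H /\ hom H G.

Section CategoricalProduct.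
Variables G H : graph.

Definition cprod_adj : rel (G * H)%type :=
  fun u v => adj u.1 v.1 && adj u.2 v.2.

Fact cprod_sym : symmetric cprod_adj.
Proof. by move=> u v; rewrite /cprod_adj adj_sym [adj u.2 _]adj_sym. Qed.

Fact cprod_irr : irreflexive cprod_adj.
Proof. by move=> u; rewrite /cprod_adj adj_irr. Qed.

Definition cprod : graph := Graph cprod_sym cprod_irr.

End CategoricalProduct.

Record hypergraph := Hypergraph {
  hvert :> finType;
  hedges : {set {set hvert}};
  hvert_gt0 : 0 < #|hvert|;
  hedges_neq0 : set0 \notin hedges
}.

Section Kneser.
Variable K : hypergraph.

Definition kneser_vert : finType := {e : {set K} | e \in hedges K}.

Definition kneser_adj : rel kneser_vert :=
  fun e f => [disjoint val e & val f].

Fact kneser_sym : symmetric kneser_adj.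
Proof. by move=> e f; rewrite /kneser_adj disjoint_sym. Qed.

Fact kneser_irr : irreflexive kneser_adj.
Proof.
move=> e; rewrite /kneser_adj -setI_eq0 setIid; apply/eqP=> e0.
by move: (hedges_neq0 K) (valP e); rewrite e0 => /negPf->.
Qed.

Definition KG : graph := Graph kneser_sym kneser_irr.

End Kneser.

(* Sign vectors have entries in option bool: Some true, Some false and None
   stand for +1, -1 and 0, so distinct nonzero entries have opposite signs. *)
Definition alternating (s : seq (option bool)) : bool :=
  all isSome s && sorted (fun x y => x != y) s.

Definition altv (n : nat) (X : n.-tuple (option bool)) : nat :=
  \max_(m : n.-tuple bool | alternating (mask m X)) size (mask m X).

Section AlternationNumbers.
Variable K : hypergraph.
Implicit Types (s : #|K|.-tuple K) (X : #|K|.-tuple (option bool)).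

Definition contains_edge (A : {set K}) : bool :=
  [exists e in hedges K, e \subset A].

(* A linear ordering of the vertices is a duplicate-free #|K|-tuple s. *)
Definition sign_part (b : bool) s X : {set K} :=
  [set tnth s j | j : 'I_#|K| & tnth X j == Some b].

Definition alt_ord s : nat :=
  \max_(X : #|K|.-tuple (option bool) |
          ~~ contains_edge (sign_part true s X)
          && ~~ contains_edge (sign_part false s X)) altv X.

Definition salt_ord s : nat :=
  \max_(X : #|K|.-tuple (option bool) |
          ~~ (contains_edge (sign_part true s X)
              && contains_edge (sign_part false s X))) altv X.

(* alt_ord s and salt_ord s never exceed #|K| and orderings exist, so the
   default value #|K| does not affect the minima, and the natural-number
   subtractions below are never truncated. *)
Definition alt : nat :=
  \big[minn/#|K|]_(s : #|K|.-tuple K | uniq s) alt_ord s.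

Definition salt : nat :=
  \big[minn/#|K|]_(s : #|K|.-tuple K | uniq s) salt_ord s.

End AlternationNumbers.

(* The two maxima range over all hypergraphs K, so their existence is a theorem
   (they are bounded by the chromatic number of G); hence the relational form. *)
Definition is_altermatic (G : graph) (z : nat) : Prop :=
  is_maximum
    (fun k => exists K : hypergraph, hom_equiv (KG K) G /\ k = #|K| - alt K) z.

Definition is_strong_altermatic (G : graph) (z : nat) : Prop :=
  is_maximum
    (fun k => exists K : hypergraph,
       hom_equiv (KG K) G /\ k = #|K| + 1 - salt K) z.

(* Main.v *)
Require Import Defs.
From HB Require Import structures.
From mathcomp Require Import all_boot.
From mathcomp Require Import zify.

(* Both numbers say that any sign vector with long enough alternation captures
   edges in its positive and/or negative part.  If KG(K1) <-> G and
   KG(K2) <-> H, the hypergraph on V(K1) + V(K2) with edges e1 + e2 represents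
   G x H, and a sign vector with few defects on the sum has few defects on each
   summand; this gives the lower bounds.  For the upper bound in (a) it is enough
   that zeta_s is monotone under homomorphisms.  Given f : KG(K) -> G, add to
   V(K) one long block of new vertices for each pair of vertices of G.  Replace
   every edge e by all the sets e + A with A meeting every block, and add for each
   v in G the union of the blocks of the non-adjacent pairs through v.  The new
   edges induce a disjoint copy of G, so the Kneser graph becomes equivalent to G,
   while a sign vector with few defects has both signs in every long block. *)

Set Implicit Arguments.
Unset Strict Implicit.
Unset Printing Implicit Defensive.

(** * Homomorphisms, alternating subsequences and minima *)

Lemma hom_trans (F G H : graph) : hom F G -> hom G H -> hom F H.
Proof.
by move=> [f hf] [g hg]; exists (g \o f) => u v uv; apply/hg/hf.
Qed.

(** Adjacency is required of all related images, so any choice of images works; [KG_ext] can then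
    describe its map by overlapping cases. *)
Lemma hom_of_rel (G H : graph) (R : G -> pred H) :
  (forall u, exists v, R u v) ->
  (forall u u' v v', adj u u' -> R u v -> R u' v' -> adj v v') -> hom G H.
Proof.
move=> Rex Radj; exists (fun u => xchoose (Rex u)) => u u' uu'.
exact: Radj uu' (xchooseP (Rex u)) (xchooseP (Rex u')).
Qed.

Lemma hom_fst (G H : graph) : hom (cprod G H) G.
Proof. by exists fst => u v /andP[]. Qed.

Lemma hom_snd (G H : graph) : hom (cprod G H) H.
Proof. by exists snd => u v /andP[]. Qed.

Lemma alternating_cat (t1 t2 : seq (option bool)) :
  alternating (t1 ++ t2) -> alternating t1 /\ alternating t2.
Proof.
rewrite /alternating all_cat => /andP[/andP[-> ->] /=].
by move=> /cat_sorted2[-> ->].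
Qed.

Lemma subseq_cat_split (t w1 w2 : seq (option bool)) :
  subseq t (w1 ++ w2) ->
  exists t1 t2, [/\ t = t1 ++ t2, subseq t1 w1 & subseq t2 w2].
Proof.
case/subseqP => m szm ->.
exists (mask (take (size w1) m) w1), (mask (drop (size w1) m) w2).
rewrite !mask_subseq -mask_cat ?cat_take_drop //.
by rewrite size_takel // szm size_cat leq_addr.
Qed.

Lemma size_subseq_map (T : Type) (c : T -> option bool) (s : seq T)
    (t : seq (option bool)) :
  subseq t (map c s) -> size t <= size s.
Proof. by move/size_subseq; rewrite size_map. Qed.

Lemma alternating_mem (t : seq (option bool)) (b : bool) :
  alternating t -> 1 < size t -> Some b \in t.
Proof.
case: t => [|[x|] [|[y|] t]] //; rewrite /alternating //= => /andP[_].
by rewrite !inE; case: x y b => [] [] [].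
Qed.

Lemma altv_leP n (X : n.-tuple (option bool)) m :
  altv X <= m <->
  (forall t, alternating t -> subseq t X -> size t <= m).
Proof.
split=> [/bigmax_leqP Xm t talt /subseqP[k szk tE]|tm].
  rewrite size_tuple in szk; have /eqP szk' := szk.
  by rewrite tE; apply: (Xm (Tuple szk')); rewrite /= -tE.
by apply/bigmax_leqP => k kalt; apply: tm => //; exact: mask_subseq.
Qed.

(** [minn] has no unit on [nat], so the default [n] takes part in the minimum; this is the first
    disjunct. *)
Lemma bigmin_leP (I : finType) (P : pred I) (F : I -> nat) n m :
  \big[minn/n]_(i | P i) F i <= m <-> n <= m \/ exists2 i, P i & F i <= m.
Proof.
split.
  elim/big_ind: _ => [|x y IHx IHy|i Pi Fi]; first by left.
    by rewrite geq_min => /orP[/IHx|/IHy].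
  by right; exists i.
have minE (r : seq I) : n <= m \/ (exists2 i, (i \in r) && P i & F i <= m) ->
    \big[minn/n]_(i <- r | P i) F i <= m.
  elim: r => [|j r IHr] nm; first by rewrite big_nil; case: nm => [|[]].
  rewrite big_cons; case: nm => [nm|[i]].
    by case: ifP => _; rewrite ?geq_min IHr ?orbT //; left.
  rewrite inE => /andP[/predU1P[->|ir] Pi] Fi; first by rewrite Pi geq_min Fi.
  have IH : \big[minn/n]_(i <- r | P i) F i <= m.
    by apply: IHr; right; exists i; rewrite ?ir.
  by case: ifP => _ //; rewrite geq_min IH orbT.
move=> nm; apply: minE; case: nm => [|[i Pi Fi]]; [by left|right].
by exists i; rewrite ?mem_index_enum.
Qed.

(** * Alternation numbers as forcing statements on colorings *)

Definition color_class (T : finType) (c : T -> option bool) (b : bool) :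
  {set T} := [set x | c x == Some b].

Definition is_ordering (T : finType) (s : seq T) : bool :=
  uniq s && (size s == #|T|).

(* [op] is [orb] for the alternation number and [andb] for the strong one. *)
Definition forced (op : rel bool) (K : hypergraph) (m : nat) : Prop :=
  exists2 s : seq K, is_ordering s &
    forall c t, alternating t -> subseq t (map c s) -> m < size t ->
    op (contains_edge (color_class c true)) (contains_edge (color_class c false)).

Lemma mem_ordering (T : finType) (s : seq T) : is_ordering s -> s =i T.
Proof.
case/andP=> su /eqP sz; apply/subset_cardP; last exact/subsetP.
by rewrite (card_uniqP su).
Qed.

(** Sign vectors are read as colorings of the vertices, which makes their two parts independent of
    the ordering. *)
Lemma sign_part_map (K : hypergraph) (s : #|K|.-tuple K) c b : uniq s ->
  sign_part b s (map_tuple c s) = color_class c b.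
Proof.
move=> su; have sE : s =i K by apply: mem_ordering; rewrite /is_ordering su size_tuple /=.
apply/setP=> x; rewrite inE; apply/imsetP/idP => [[j]|cx].
  by rewrite inE tnth_map => /eqP cj ->; apply/eqP.
have /tnthP[j xj] : x \in s by rewrite sE.
by exists j => //; rewrite inE tnth_map -xj.
Qed.

Lemma tuple_mapE (T : finType) (s : #|T|.-tuple T)
    (X : #|T|.-tuple (option bool)) : uniq s ->
  exists c, X = map_tuple c s.
Proof.
move=> su; exists (fun x => nth None X (index x s)); apply: eq_from_tnth => j.
rewrite tnth_map (tnth_nth (tnth s j)) (tnth_nth None) index_uniq //.
by rewrite size_tuple.
Qed.

Lemma bigmin_forcedP (op : rel bool) (K : hypergraph) m :
  \big[minn/#|K|]_(s : #|K|.-tuple K | uniq s)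
    \max_(X : #|K|.-tuple (option bool) |
      ~~ op (contains_edge (sign_part true s X))
            (contains_edge (sign_part false s X))) altv X <= m
  <-> forced op K m.
Proof.
split=> [/bigmin_leP[Km|[s su /bigmax_leqP Xm]]|[s so sm]].
(* The default case: no subsequence has more than [#|K|] terms, so any ordering works vacuously. *)
- exists (enum K); first by rewrite /is_ordering enum_uniq -cardE eqxx.
  move=> c t _ /size_subseq; rewrite size_map -cardE => tK mt.
  by have := leq_trans mt (leq_trans tK Km); rewrite ltnn.
- exists (val s); first by rewrite /is_ordering su size_tuple /=.
  move=> c t ta ts mt; apply: contraLR mt => nop; rewrite -leqNgt.
  have := Xm (map_tuple c s); rewrite !sign_part_map // => /(_ nop).
  by move/altv_leP; apply.
apply/bigmin_leP; right; case/andP: so => su sz; exists (Tuple sz) => //.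
apply/bigmax_leqP => X; have [//|c ->] := @tuple_mapE _ (Tuple sz) X.
rewrite !sign_part_map // => nop; apply/altv_leP => t ta ts.
by rewrite leqNgt; apply: contra nop => /(sm _ _ ta ts).
Qed.

Lemma alt_leP (K : hypergraph) m : alt K <= m <-> forced orb K m.
Proof.
rewrite -bigmin_forcedP /alt /alt_ord.
by under [X in _ <-> is_true (X <= m)]eq_bigr => s _ do
  under eq_bigl => X do rewrite negb_or.
Qed.

Lemma salt_leP (K : hypergraph) m : salt K <= m <-> forced andb K m.
Proof. exact: (bigmin_forcedP andb). Qed.

Lemma alt_le_card (K : hypergraph) : alt K <= #|K|.
Proof. by apply/bigmin_leP; left. Qed.

Lemma salt_le_card (K : hypergraph) : salt K <= #|K|.
Proof. by apply/bigmin_leP; left. Qed.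

Definition kneser_edge (K : hypergraph) (e : {set K}) (eK : e \in hedges K) :
  KG K := exist _ e eK.

(** * Sets and orderings on a disjoint sum *)

Section SumSets.
Variables S T : finType.

Definition sum_set (A : {set S}) (B : {set T}) : {set S + T} :=
  [set x | match x with inl a => a \in A | inr b => b \in B end].

Lemma sum_setl A B : inl @^-1: sum_set A B = A.
Proof. by apply/setP=> x; rewrite !inE. Qed.

Lemma sum_setr A B : inr @^-1: sum_set A B = B.
Proof. by apply/setP=> x; rewrite !inE. Qed.

Lemma disjoint_sum (A B : {set S + T}) :
  [disjoint A & B] =
  [disjoint inl @^-1: A & inl @^-1: B] && [disjoint inr @^-1: A & inr @^-1: B].
Proof.
rewrite -!setI_eq0; apply/eqP/andP => [/setP AB|[/eqP/setP ABl /eqP/setP ABr]].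
  by split; apply/eqP/setP=> x; [have := AB (inl x) | have := AB (inr x)];
    rewrite !inE.
by apply/setP=> -[x|x]; [have := ABl x | have := ABr x]; rewrite !inE.
Qed.

Lemma is_ordering_sum (s : seq S) (t : seq T) :
  is_ordering s -> is_ordering t -> is_ordering (map inl s ++ map inr t).
Proof.
case/andP=> su /eqP sz /andP[tu /eqP tz]; rewrite /is_ordering cat_uniq.
rewrite !map_inj_uniq ?su ?tu; try by move=> ? ? [].
rewrite size_cat !size_map sz tz card_sum eqxx /= !andbT.
by apply/hasPn => x /mapP[y _ ->]; apply/mapP => -[].
Qed.

Lemma alternating_sum_split (s1 : seq S) (s2 : seq T) c t :
  alternating t -> subseq t (map c (map inl s1 ++ map inr s2)) ->
  exists t1 t2, [/\ size t = size t1 + size t2,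
    alternating t1 /\ subseq t1 (map (c \o inl) s1) &
    alternating t2 /\ subseq t2 (map (c \o inr) s2)].
Proof.
move=> ta; rewrite map_cat -!map_comp => /subseq_cat_split[t1 [t2 [tE ts1 ts2]]].
move: ta; rewrite tE => /alternating_cat[ta1 ta2].
by exists t1, t2; rewrite size_cat.
Qed.

End SumSets.

(** * The hypergraph representing a categorical product *)

Section ProductHypergraph.
Variables K1 K2 : hypergraph.

Definition prod_edges : {set {set K1 + K2}} :=
  [set e : {set K1 + K2} | (inl @^-1: e \in hedges K1) && (inr @^-1: e \in hedges K2)].

Fact prod_vert_gt0 : 0 < #|{: K1 + K2}|.
Proof. by rewrite card_sum addn_gt0 hvert_gt0. Qed.

Fact prod_edges_neq0 : set0 \notin prod_edges.
Proof. by rewrite inE preimset0 (negPf (hedges_neq0 K1)). Qed.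

Definition prod_hyp := Hypergraph prod_vert_gt0 prod_edges_neq0.

(** Two sets in a disjoint sum are disjoint exactly when both pairs of traces are, which is
    adjacency in the product; traces give one map and [sum_set] the other. *)
Lemma KG_prod (G H : graph) : hom_equiv (KG K1) G -> hom_equiv (KG K2) H ->
  hom_equiv (KG prod_hyp) (cprod G H).
Proof.
move=> [[f hf] [f' hf']] [[g hg] [g' hg']]; split.
  have el (e : KG prod_hyp) : inl @^-1: val e \in hedges K1.
    by have := valP e; rewrite inE => /andP[].
  have er (e : KG prod_hyp) : inr @^-1: val e \in hedges K2.
    by have := valP e; rewrite inE => /andP[].
  exists (fun e => (f (kneser_edge (el e)), g (kneser_edge (er e)))) => e e'.
  rewrite /= /kneser_adj disjoint_sum => /andP[dl dr].
  by apply/andP; split; [apply: hf | apply: hg].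
have ein (u : cprod G H) : sum_set (val (f' u.1)) (val (g' u.2)) \in hedges prod_hyp.
  by rewrite inE sum_setl sum_setr; apply/andP; split; apply: valP.
exists (fun u => kneser_edge (ein u)) => u v /andP[uv1 uv2].
rewrite /= /kneser_adj disjoint_sum /= !sum_setl !sum_setr.
by apply/andP; split; [apply: hf' | apply: hg'].
Qed.

Lemma contains_edge_prod (c : K1 + K2 -> option bool) b :
  contains_edge (color_class (c \o inl) b) &&
  contains_edge (color_class (c \o inr) b) ->
  contains_edge (K := prod_hyp) (color_class c b).
Proof.
case/andP=> /exists_inP[e eK /subsetP ec] /exists_inP[f fK /subsetP fc].
apply/exists_inP; exists (sum_set e f); first by rewrite inE sum_setl sum_setr eK.
by apply/subsetP=> -[x|x]; rewrite inE; [move/ec | move/fc]; rewrite !inE.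
Qed.

(** At most [#|K1|] terms of [t] lie in the first summand, so more than [m2] lie in the second, and
    symmetrically. [opP] combines the colors captured in the summands: a color captured in both is
    captured in the sum. *)
Lemma forced_prod (op1 op2 op : rel bool) m1 m2 :
  (forall a b c d x y : bool, op1 a b -> op2 c d ->
     (a && c -> x) -> (b && d -> y) -> op x y) ->
  forced op1 K1 m1 -> forced op2 K2 m2 ->
  forced op prod_hyp (maxn (#|K1| + m2) (#|K2| + m1)).
Proof.
move=> opP [s1 so1 f1] [s2 so2 f2].
exists (map inl s1 ++ map inr s2); first exact: is_ordering_sum.
move=> c t ta /(alternating_sum_split ta)[t1 [t2 [-> [ta1 ts1] [ta2 ts2]]]] mt.
have := size_subseq_map ts1; have := size_subseq_map ts2.
case/andP: so1 so2 => _ /eqP-> /andP[_ /eqP->] le2 le1.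
apply: opP (f1 _ _ ta1 ts1 _) (f2 _ _ ta2 ts2 _) _ _; try lia.
all: exact: contains_edge_prod.
Qed.

End ProductHypergraph.

(** * Extending a hypergraph along a homomorphism to [G] *)

Section ExtensionHypergraph.
Variables (K : hypergraph) (G : graph).

(** With blocks of size [#|K|.+2], an alternating subsequence missing at most [#|K|] block vertices
    keeps two terms in each block, hence both signs. *)
Definition block_vert : finType := ('I_(#|K|.+2) * (G * G))%type.

Definition nonadj_blocks (v : G) : {set K + block_vert} :=
  [set x | if x is inr (_, (a, b)) then ~~ adj a b && ((a == v) || (b == v))
           else false].

Definition meets_blocks (e : {set K + block_vert}) : bool :=
  [forall p, exists i, inr (i, p) \in e].

Definition ext_edges : {set {set K + block_vert}} :=
  [set e : {set K + block_vert} | (inl @^-1: e \in hedges K) && meets_blocks e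
        || [exists v, e == nonadj_blocks v]].

Fact ext_vert_gt0 : 0 < #|{: K + block_vert}|.
Proof. by rewrite card_sum addn_gt0 hvert_gt0. Qed.

Lemma diag_nonadj_blocks v i : inr (i, (v, v)) \in nonadj_blocks v.
Proof. by rewrite inE adj_irr eqxx. Qed.

Fact ext_edges_neq0 : set0 \notin ext_edges.
Proof.
rewrite inE preimset0 (negPf (hedges_neq0 K)) /=; apply/existsP=> -[v /eqP/setP].
by move=> /(_ (inr (ord0, (v, v)))); rewrite diag_nonadj_blocks inE.
Qed.

Definition ext_hyp := Hypergraph ext_vert_gt0 ext_edges_neq0.

(** Nonadjacent [u] and [v] share the block [(u, v)]. If they are adjacent, hence distinct, a common
    block could only be [(u, v)] or [(v, u)], and neither is a nonadjacent pair. *)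
Lemma disjoint_nonadj_blocks u v :
  [disjoint nonadj_blocks u & nonadj_blocks v] = adj u v.
Proof.
rewrite -setI_eq0; apply/eqP/idP => [/setP/(_ (inr (ord0, (u, v))))|uv].
  by rewrite !inE !eqxx orbT !andbT andbb => /negbFE.
apply/setP=> -[x|[i [a b]]]; rewrite !inE //.
apply/negbTE/negP=> /andP[/andP[nab au] /andP[_ av]]; move: nab uv.
by case/orP: au av => /eqP-> /orP[]/eqP->; rewrite ?adj_irr // 1?adj_sym => /negPf->.
Qed.

(** The diagonal block [(v, v)] is a common one. Hence the Kneser graph has no adjacency between
    enlarged old edges and new edges. *)
Lemma meets_nonadj_blocks e v : meets_blocks e -> ~~ [disjoint e & nonadj_blocks v].
Proof.
move/forallP/(_ (v, v))/existsP=> [i ie]; rewrite -setI_eq0; apply/set0Pn.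
by exists (inr (i, (v, v))); rewrite in_setI ie diag_nonadj_blocks.
Qed.

Lemma KG_ext : hom (KG K) G -> hom_equiv (KG ext_hyp) G.
Proof.
case=> f hf; split.
  (* A new edge goes to its vertex of [G], an enlarged old edge to the image under [f] of its trace
     on [K]. *)
  pose R (e : KG ext_hyp) : pred G := fun v => (val e == nonadj_blocks v) ||
    meets_blocks (val e) &&
      [exists e0 : KG K, (val e0 == inl @^-1: val e) && (f e0 == v)].
  apply: (hom_of_rel (R := R)).
    move=> e; have := valP e; rewrite /R inE => /orP[/andP[eK em]|/existsP[v ev]].
      exists (f (kneser_edge eK)); rewrite em; apply/orP; right.
      by apply/existsP; exists (kneser_edge eK); rewrite /= !eqxx.
    by exists v; rewrite ev.
  move=> e e' v v'; rewrite /R /= /kneser_adj => dee'.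
  case/orP=> [/eqP ev|/andP[em /existsP[e0 /andP[/eqP e0E /eqP<-]]]];
  case/orP=> [/eqP ev'|/andP[em' /existsP[e0' /andP[/eqP e0E' /eqP<-]]]].
  - by rewrite -disjoint_nonadj_blocks -ev -ev'.
  - by have := meets_nonadj_blocks v em'; rewrite -ev disjoint_sym dee'.
  - by have := meets_nonadj_blocks v' em; rewrite -ev' dee'.
  - apply: hf; rewrite /= /kneser_adj /= e0E e0E'.
    by move: dee'; rewrite disjoint_sum => /andP[].
have gin v : nonadj_blocks v \in hedges ext_hyp.
  by rewrite inE; apply/orP; right; apply/existsP; exists v.
by exists (fun v => kneser_edge (gin v)) => u v; rewrite /= /kneser_adj disjoint_nonadj_blocks.
Qed.

(* The vertices of each block are consecutive. *)
Definition block_order : seq block_vert :=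
  [seq (i, p) | p <- enum {: G * G}, i <- enum 'I_(#|K|.+2)].

Lemma block_order_ordering : is_ordering block_order.
Proof.
rewrite /is_ordering size_allpairs -!cardE mulnC -card_prod eqxx andbT.
by apply: allpairs_uniq; rewrite ?enum_uniq // => -[p i] [p' i'] _ _ [-> ->].
Qed.

Lemma block_has_color (c : block_vert -> option bool) t b p :
  alternating t -> subseq t (map c block_order) ->
  size block_order <= size t + #|K| -> exists i, c (i, p) = Some b.
Proof.
(* Cut the order around the block of [p]; [t2] is the portion of [t] in that block. *)
have /splitPr : p \in enum {: G * G} by rewrite mem_enum.
rewrite /block_order; case=> r1 r2.
rewrite allpairs_cat allpairs_cons !map_cat.
move=> ta /subseq_cat_split[t1 [u [tE ts1]]].
case/subseq_cat_split=> t2 [t3 [uE ts2 ts3]].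
move: ta; rewrite tE uE => /alternating_cat[_ /alternating_cat[ta _]].
have := size_subseq_map ts1; have := size_subseq_map ts3.
rewrite !size_cat [size (map _ (enum _))]size_map size_enum_ord => le3 le1 le.
(* [t1] and [t3] at most fill the other blocks, so all the missing terms, at most [#|K|], could be
   charged to this block and two would still remain. *)
have t2_gt1 : 1 < size t2 by lia.
have := mem_subseq ts2 (alternating_mem b ta t2_gt1).
by rewrite -map_comp => /mapP[i _ ->]; exists i.
Qed.

Lemma contains_edge_ext (c : K + block_vert -> option bool) b :
  contains_edge (color_class (c \o inl) b) ->
  (forall p, exists i, c (inr (i, p)) = Some b) ->
  contains_edge (K := ext_hyp) (color_class c b).
Proof.
case/exists_inP=> e eK /subsetP ec cb; apply/exists_inP.
(* Enlarge [e] by all block vertices of color [b]; by hypothesis they meet every block. *)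
exists (sum_set e (color_class (c \o inr) b)).
  rewrite inE sum_setl eK; apply/orP; left; apply/forallP=> p.
  by apply/existsP; have [i ci] := cb p; exists i; rewrite !inE /= ci.
by apply/subsetP=> -[x|x]; rewrite inE; [move/ec|]; rewrite !inE.
Qed.

Lemma forced_ext m : forced andb K m -> forced andb ext_hyp (m + #|block_vert|).
Proof.
move=> [s so f]; exists (map inl s ++ map inr block_order).
  exact: is_ordering_sum so block_order_ordering.
move=> c t ta /(alternating_sum_split ta)[t1 [t2 [-> [ta1 ts1] [ta2 ts2]]]] mt.
have := size_subseq_map ts1; have := size_subseq_map ts2.
case/andP: so block_order_ordering => _ /eqP-> /andP[_ /eqP sz]; rewrite sz => le2 le1.
have [|ct cf] := andP (f _ _ ta1 ts1 _); first lia.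
(* [t1] has at most [#|K|] terms, which bounds the number of block vertices missed by [t2]. *)
have le : size block_order <= size t2 + #|K| by rewrite sz; lia.
by apply/andP; split; apply: contains_edge_ext => // p;
  apply: block_has_color ta2 ts2 le.
Qed.

End ExtensionHypergraph.

(** The extension represents [G], and its vertex count and its bound on [salt] both exceed those of
    [K] by [#|block_vert K G|], so the value does not drop. *)
Lemma strong_altermatic_mono (G : graph) (K : hypergraph) z :
  hom (KG K) G -> is_strong_altermatic G z -> #|K| + 1 - salt K <= z.
Proof.
move=> KG_G [_ zmax].
have := zmax _ (ex_intro _ (ext_hyp K G) (conj (KG_ext KG_G) erefl)).
have /salt_leP : forced andb (ext_hyp K G) (salt K + #|block_vert K G|).
  by apply: forced_ext; apply/salt_leP.
have -> : #|ext_hyp K G| = #|K| + #|block_vert K G| by rewrite -card_sum.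
lia.
Qed.

(** * Bounds for the product hypergraph and the theorem *)

Lemma salt_prod (K1 K2 : hypergraph) :
  salt (prod_hyp K1 K2) <= maxn (#|K1| + salt K2) (#|K2| + salt K1).
Proof.
apply/salt_leP/(@forced_prod _ _ andb andb); try exact/salt_leP.
by move=> [] [] [] [] [] [] //= _ _ hx hy; first [exact: hx | exact: hy].
Qed.

(** The strong factor [K2] captures both colors, so it matches whichever color [K1] captures. *)
Lemma alt_prod_salt (K1 K2 : hypergraph) :
  alt (prod_hyp K1 K2) <= maxn (#|K1| + salt K2) (#|K2| + alt K1).
Proof.
apply/alt_leP/(@forced_prod _ _ orb andb); [|exact/alt_leP|exact/salt_leP].
by move=> [] [] [] [] [] [] //= _ _ hx hy; first [exact: hx | exact: hy].
Qed.

Lemma alt_salt_prod (K1 K2 : hypergraph) :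
  alt (prod_hyp K1 K2) <= maxn (#|K1| + alt K2) (#|K2| + salt K1).
Proof.
apply/alt_leP/(@forced_prod _ _ andb orb); [|exact/salt_leP|exact/alt_leP].
by move=> [] [] [] [] [] [] //= _ _ hx hy; first [exact: hx | exact: hy].
Qed.

Theorem theorem1 (G H : graph) (hG : 0 < #|G|) (hH : 0 < #|H|) :
  (forall zsG zsH : nat,
     is_strong_altermatic G zsG ->
     is_strong_altermatic H zsH ->
     is_strong_altermatic (cprod G H) (minn zsG zsH))
  /\
  (forall zG zsG zH zsH zGH : nat,
     is_altermatic G zG ->
     is_strong_altermatic G zsG ->
     is_altermatic H zH ->
     is_strong_altermatic H zsH ->
     is_altermatic (cprod G H) zGH ->
     maxn (minn zG (zsH - 1)) (minn (zsG - 1) zH) <= zGH).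
Proof.
have cardP (K1 K2 : hypergraph) : #|prod_hyp K1 K2| = #|K1| + #|K2|.
  by rewrite -card_sum.
split=> [zsG zsH zG zH|zG zsG zH zsH zGH].
  (* Upper bound: compose with the projections and use monotonicity in each factor. *)
  have ub (K : hypergraph) : hom (KG K) (cprod G H) ->
      #|K| + 1 - salt K <= minn zsG zsH.
    move=> hK; rewrite leq_min (strong_altermatic_mono (hom_trans hK (hom_fst G H)) zG).
    exact: strong_altermatic_mono (hom_trans hK (hom_snd G H)) zH.
  split=> [|j [K [[hK _] ->]]]; last exact: ub.
  have [[K1 [KG1 e1]] _] := zG; have [[K2 [KG2 e2]] _] := zH.
  have KGP := KG_prod KG1 KG2.
  exists (prod_hyp K1 K2); split=> //; have := ub _ KGP.1; rewrite cardP.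
  (* The product of two optimal hypergraphs reaches the minimum; the bounds by vertex counts keep
     the subtractions exact. *)
  have := salt_prod K1 K2; have := salt_le_card K1; have := salt_le_card K2; lia.
(* [K1] and [K2] attain the altermatic numbers, [L1] and [L2] the strong ones. Pairing one of each
   kind, the [- 1] in the claim cancels the [+ 1] in the strong value. *)
move=> [[K1 [KG1 e1]] _] [[L1 [LG1 d1]] _] [[K2 [KG2 e2]] _] [[L2 [LG2 d2]] _] [_ ub].
have := ub _ (ex_intro _ (prod_hyp K1 L2) (conj (KG_prod KG1 LG2) erefl)).
have := ub _ (ex_intro _ (prod_hyp L1 K2) (conj (KG_prod LG1 KG2) erefl)).
rewrite !cardP.
have := alt_prod_salt K1 L2; have := alt_salt_prod L1 K2.
have := alt_le_card K1; have := salt_le_card L2.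
have := salt_le_card L1; have := alt_le_card K2; lia.
Qed.
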